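(* Let $(X,P)$ be an irreducible, transient random walk on an at most countable set $X$, let $o\in X$, and let $\mu$ be a (signed) measure on $X$ with finite support. Let $\partial X$ be the Martin boundary of $(X,P)$ and $k_o$ the (extended) Martin kernel. Consider the assertions: (i) $\mu$ has the weak mean value property with respect to $o$; (ii) $L(k_o(\cdot,\xi),\mu)(o)=0$ for almost every $\xi\in\partial X$ (with respect to the harmonic measures). Then (ii) $\Longrightarrow$ (i). In particular, if the Martin compactification is almost regular, then (i) $\Longleftrightarrow$ (ii).
   Context: $X$ is an at most countable set and $P=(p(x,y))_{x,y\in X}$ is a Markov operator: $p(x,y)\ge 0$, $\sum_{y}p(x,y)=1$, $(Pf)(x)=\sum_y p(x,y)f(y)$ whenever $\sum_y p(x,y)|f(y)|<\infty$ for all $x$. $f:X\to\mathbb{R}$ is harmonic if $Pf=f$; $\mathcal H(X,P)$ is the set of harmonic functions and $\mathcal H^\infty(X,P)$ the set of bounded ones. $Z_n$ denotes the associated Markov chain, $\Pr_x$ its law started from $x$, and $F(x,y)=\Pr_x(\exists n\ge 0: Z_n=y)$ (so $F(x,x)=1$). Compactification: a compactification of the discrete set $X$ is a compact Hausdorff space $\widehat X$ containing $X$ as an open, discrete, dense subset; $\partial X=\widehat X\setminus X$. The Martin kernel is $k_o(x,y)=F(x,y)/F(o,y)$, $x,y\in X$. The Martin compactification $\widehat X$ is the unique (up to homeomorphism) smallest compactification of the discrete set $X$ to which all functions $k_o(x,\cdot)$, $x\in X$, extend continuously (it does not depend on $o$, up to homeomorphism); the extensions are again denoted $k_o(x,\cdot)$,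 and $\partial X=\widehat X\setminus X$ is the Martin boundary. The chain converges $\Pr_x$-almost surely to a random variable $Z_\infty$ with values in $\partial X$ for every starting point $x$; the harmonic measures are $\nu_x(A)=\Pr_x(Z_\infty\in A)$ for Borel $A\subseteq\partial X$. They are mutually absolutely continuous, and ''almost every'' on $\partial X$ means with respect to one (equivalently, every) $\nu_x$. A boundary point $\xi\in\partial X$ is regular if for every sequence $(x_n)$ in $X$ converging to $\xi$ in $\widehat X$, the measures $\nu_{x_n}$ converge weakly to $\delta_\xi$, i.e. $\int_{\partial X} f\,d\nu_{x_n}\to f(\xi)$ for all $f\in C(\partial X)$. The compactification is almost regular if the set of regular boundary points has $\nu_x$-measure $1$ for some (equivalently, every) $x\in X$. For a signed measure $\mu$ of finite variation on the power set of $X$ and $h\in L^1(|\mu|)$, put $L(h,\mu)(x)=\int_X h\,d\mu-\mu(X)h(x)$. $\mu$ has the weak mean value property with respect to $o$ if $L(h,\mu)(o)=0$ for all $h\in\mathcal H^\infty(X,P)$. *)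

(* Defs.v *)
From HB Require Import structures.
From mathcomp Require Import all_boot all_order all_algebra.
From mathcomp Require Import all_classical all_reals all_analysis.

Set Implicit Arguments.
Unset Strict Implicit.
Unset Printing Implicit Defensive.

Import Order.TTheory GRing.Theory Num.Theory.
Import numFieldNormedType.Exports.

Local Open Scope classical_set_scope.
Local Open Scope ring_scope.
Local Open Scope ereal_scope.

(* The state space of the walk is an at most countable set, on which signed
   measures live on the power set. *)
Definition countable_discrete d (X : measurableType d) : Prop :=
  countable [set: X] /\ forall A : set X, measurable A.

(* Sum of a real family; it is meaningful for absolutely summable families
   only, and is only used together with [summable]. *)
Definition rsum (R : realType) (X : choiceType) (f : X -> R) : R :=
  (fine (\esum_(y in [set: X]) (f^\+ y)%:E)
   - fine (\esum_(y in [set: X]) (f^\- y)%:E))%R.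

Section MarkovOperator.
Context (R : realType) (X : choiceType).
Implicit Types (p : X -> X -> R) (f : X -> R).

Definition markov_operator p : Prop :=
  (forall x y, (0 <= p x y)%R) /\
  forall x, \esum_(y in [set: X]) (p x y)%:E = 1.

Definition harmonic p f : Prop :=
  forall x, summable [set: X] (fun y => (p x y * f y)%:E) /\
            rsum (fun y => p x y * f y)%R = f x.

Definition bounded_harmonic p f : Prop :=
  harmonic p f /\ exists M : R, forall x, (`|f x| <= M)%R.

Fixpoint step_prob p (n : nat) (x y : X) : \bar R :=
  if n is m.+1 then \esum_(z in [set: X]) ((p x z)%:E * step_prob p m z y)
  else ((x == y)%:R)%:E.

Definition irreducible p : Prop :=
  forall x y, exists n, 0 < step_prob p n x y.

Definition transient p : Prop :=
  forall x y, \sum_(0 <= n <oo) step_prob p n x y < +oo.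

End MarkovOperator.

Section MarkovChain.
Context (R : realType) d (X : measurableType d)
        d' (Omega : measurableType d').
Implicit Types (p : X -> X -> R) (Pr : X -> probability Omega R).

Definition markov_chain p Pr (Z : nat -> {mfun Omega >-> X}) : Prop :=
  forall (x : X) (n : nat) (s : nat -> X),
    Pr x [set w | forall i, (i <= n)%N -> Z i w = s i] =
    ((s 0%N == x)%:R * \prod_(i < n) p (s i) (s i.+1))%:E.

Definition hitting_prob Pr (Z : nat -> {mfun Omega >-> X}) (x y : X) : R :=
  fine (Pr x [set w | exists n, Z n w = y]).

Definition martin_kernel Pr (Z : nat -> {mfun Omega >-> X}) (o x y : X) : R :=
  (hitting_prob Pr Z x y / hitting_prob Pr Z o y)%R.

End MarkovChain.

Section Compactification.
Context (R : realType) (X : Type).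

(* The image of [iota] is open and discrete iff its points are open. *)
Definition compactification (Y : topologicalType) (iota : X -> Y) : Prop :=
  [/\ compact [set: Y], hausdorff_space Y, injective iota,
      forall x, open [set iota x] & dense (range iota)].

Definition boundary (Y : topologicalType) (iota : X -> Y) : set Y :=
  ~` range iota.

Definition continuous_extension (Y : topologicalType) (iota : X -> Y)
    (f : X -> R) (g : Y -> R) : Prop :=
  continuous g /\ forall x, g (iota x) = f x.

Definition extends_family (I : Type) (k : I -> X -> R)
    (Y : topologicalType) (iota : X -> Y) : Prop :=
  forall i, exists g : Y -> R, continuous_extension iota (k i) g.

(* Compactifications are ordered by the existence of a continuous map that is
   the identity on [X]. *)
Definition smallest_compactification (I : Type) (k : I -> X -> R)
    (Y : topologicalType) (iota : X -> Y) : Prop :=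
  [/\ compactification iota, extends_family k iota &
      forall (Y' : topologicalType) (iota' : X -> Y'),
        compactification iota' -> extends_family k iota' ->
        exists pi : Y' -> Y, continuous pi /\ forall x, pi (iota' x) = iota x].

End Compactification.

Definition martin_compactification (R : realType) d (X : measurableType d)
    d' (Omega : measurableType d') (Pr : X -> probability Omega R)
    (Z : nat -> {mfun Omega >-> X}) (o : X)
    (Y : topologicalType) (iota : X -> Y) : Prop :=
  smallest_compactification (martin_kernel Pr Z o) iota.

(* A topological space with its Borel sigma-algebra. *)
Notation borel Y := (g_sigma_algebraType (@open Y)).

Section HarmonicMeasure.
Context (R : realType) d (X : measurableType d)
        d' (Omega : measurableType d') (Y : ptopologicalType).
Variables (Pr : X -> probability Omega R) (Z : nat -> {mfun Omega >-> X})
          (iota : X -> Y) (Zoo : {mfun Omega >-> borel Y}).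

Definition limit_variable : Prop :=
  (forall w, boundary iota (Zoo w)) /\
  forall x, {ae Pr x, forall w, (fun n => iota (Z n w)) @ \oo --> (Zoo w : Y)}.

(* The harmonic measures are Borel measures on the whole compactification,
   carried by the boundary when [limit_variable] holds. *)
Definition harmonic_measure (x : X) : probability (borel Y) R :=
  distribution (Pr x) Zoo.

Definition regular_point (xi : Y) : Prop :=
  boundary iota xi /\
  forall u : nat -> X, (fun n => iota (u n)) @ \oo --> xi ->
  forall f : Y -> R, {within boundary iota, continuous f} ->
    (fun n => \int[harmonic_measure (u n)]_(z in boundary iota) (f z)%:E)
      @ \oo --> (f xi)%:E.

Definition almost_regular : Prop :=
  exists x, harmonic_measure x [set xi | regular_point xi] = 1.

End HarmonicMeasure.

Section SignedMeasure.
Context (R : realType) d (X : measurableType d).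
Implicit Types (mu : {charge set X -> \bar R}) (h : X -> R).

Definition finitely_supported mu : Prop :=
  finite_set [set x | mu [set x] != 0].

(* Integral with respect to a signed measure, through its Jordan decomposition;
   it does not depend on the Hahn decomposition chosen. *)
Definition charge_integral mu h : R :=
  let HP := cid (Hahn_decomposition mu) in
  let HN := cid (projT2 HP) in
  fine (\int[jordan_pos (projT2 HN)]_x (h x)%:E
        - \int[jordan_neg (projT2 HN)]_x (h x)%:E).

Definition mean_value_defect h mu (x : X) : R :=
  (charge_integral mu h - fine (mu [set: X]) * h x)%R.

Definition weak_mean_value (p : X -> X -> R) mu (o : X) : Prop :=
  forall h, bounded_harmonic p h -> mean_value_defect h mu o = 0%R.

End SignedMeasure.

(* Main.v *)
Require Import Defs.
From HB Require Import structures.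
From mathcomp Require Import all_boot all_order all_algebra.
From mathcomp Require Import all_classical all_reals all_analysis.
From mathcomp Require Import measurable_realfun.

Set Implicit Arguments.
Unset Strict Implicit.
Unset Printing Implicit Defensive.

Import Order.TTheory GRing.Theory Num.Theory.
Import numFieldNormedType.Exports.

Local Open Scope classical_set_scope.
Local Open Scope ring_scope.

(** Let [c] be the finite family of masses of [mu], and for a function [h] put
    [L h = \sum_x c x * (h x - h o)]; this is the mean value defect of [h].
    Write [Phi xi = L (k ^~ xi)], a continuous function on the compactification.
    Everything rests on one formula which expresses [L h], for [h] bounded and
    harmonic, through [Phi] alone, and which needs neither the Poisson
    representation of [h] nor martingale convergence.

    Fix a finite set [B] of states and stop the chain at its last visit to [B].
    Let [T] be the one-step average of the chain killed when it enters [B].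
    Splitting the paths of length [N] at their last visit to [B] gives, for [x]
    in [B],
    [h x = \sum_(n <= N) \sum_(y in B) p^n(x, y) * T^(N - n) h y].
    As [h] is excessive, [T^m h] decreases to a limit [r_h] (the residual), and
    transience lets [N] tend to infinity:
    [h x = \sum_(y in B) G(x, y) * r_h y], with [G] the Green function.  Since
    [G(x, y) = F(x, y) * G(y, y)], the Martin kernel turns the starting point [x]
    into [o]: [G(x, y) = G(o, y) * k x y].  Hence
    [L h = \sum_(y in B) G(o, y) * r_h y * Phi y] as soon as [B] contains [o]
    and the support of [mu].

    For [h = 1] the weight [G(x, y) * r_1 y] is the probability, starting from
    [x], that [y] is the last state of [B] to be visited.  When [B] exhausts the
    state space the last visit happens later and later, so that
    [\sum_(y in B) G(x, y) * r_1 y * phi y] tends to the expectation under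
    [Pr x] of [phi] at the limit point of the chain, for every
    nonnegative continuous [phi] (lemma [last_exit_sum_cvg]).  The two implications follow.

    Suppose that [Phi] vanishes almost everywhere.  Adding a constant to [h] does
    not change [L h], so one may take [0 <= h <= M]; then [r_h <= M * r_1],
    and [`|L h|] is at most [M * \sum_(y in B) G(o, y) * r_1 y * `|Phi y|], which
    tends to [M] times the expectation of [`|Phi|] at the limit point, that is
    to 0 (lemma [weak_mean_value_of_kernel]).

    Conversely let [C] bound [`|Phi|].  The expectation, as a function of the
    starting point, of the nonnegative function [Phi + C] at the limit point is
    bounded and harmonic, so the weak mean value property says that [L] kills
    it, and [L] kills constants.  Both functions are limits of last-exit sums,
    in which the Martin kernel again turns the starting points into [o]; the two
    facts then say that [\sum_(y in B) G(o, y) * r_1 y * Phi y ^+ 2] tends to 0.  As [k x] is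
    bounded, the same holds with [x] in place of [o], so [Phi ^+ 2] has
    expectation 0 at the limit point, whatever the starting point (lemma
    [kernel_of_weak_mean_value]). *)

(** * Averages, killed chains and the decomposition at the last visit *)

Section Esum.
Context (R : realType).
Local Open Scope ereal_scope.

Lemma ge0_esumZl (T : choiceType) (I : set T) (c : R) (a : T -> \bar R) :
  (0 <= c)%R -> (forall i, 0 <= a i) ->
  \esum_(i in I) (c%:E * a i) = c%:E * \esum_(i in I) a i.
Proof.
rewrite le_eqVlt => /orP[/eqP<-|c0] a0.
  by rewrite mul0e esum1// => i _; rewrite mul0e.
apply/eqP; rewrite eq_le; apply/andP; split.
  apply: ge_ereal_sup => _ [A [finA AI] <-].
  rewrite -ge0_mule_fsumr//.
  by apply: lee_wpmul2l; [rewrite lee_fin ltW|apply: esum_ge; exists A].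
rewrite -lee_pdivlMl//; apply: ge_ereal_sup => _ [A [finA AI] <-].
rewrite lee_pdivlMl//; apply: esum_ge; exists A => //.
by rewrite -ge0_mule_fsumr.
Qed.

Lemma esum_nneseries (T : choiceType) (I : set T) (a : T -> nat -> \bar R) :
  (forall i n, 0 <= a i n) ->
  \esum_(i in I) \sum_(0 <= n <oo) a i n =
  \sum_(0 <= n <oo) \esum_(i in I) a i n.
Proof.
move=> a0; rewrite nneseries_esumT; last by move=> n; exact: esum_ge0.
under eq_esum do rewrite nneseries_esumT//.
rewrite !esum_esum//.
rewrite (reindex_esum ([set: nat] `*`` (fun=> I)) _ (fun x => (x.2, x.1)))//.
split=> [[n i] []//|[n i] [m j] /= _ _ [-> ->]//|[i n] [/= Ii _]].
by exists (n, i).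
Qed.

End Esum.

Section Average.
Context (R : realType) (X : choiceType) (p : X -> X -> R)
  (hp : markov_operator p).
Local Open Scope ereal_scope.
Implicit Types (f g : X -> \bar R) (B : seq X).

Definition average f (x : X) : \bar R :=
  \esum_(z in [set: X]) ((p x z)%:E * f z).

Lemma average_ge0 f x : (forall z, 0 <= f z) -> 0 <= average f x.
Proof.
by move=> f0; apply: esum_ge0 => z _; rewrite mule_ge0// lee_fin; exact: hp.1.
Qed.

Lemma le_average f g x : (forall z, f z <= g z) -> average f x <= average g x.
Proof.
by move=> fg; apply: le_esum => z _; rewrite lee_wpmul2l// lee_fin; exact: hp.1.
Qed.

Lemma eq_average f g x : (forall z, f z = g z) -> average f x = average g x.
Proof. by move=> fg; apply: eq_esum => z _; rewrite fg. Qed.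

Lemma averageD f g x : (forall z, 0 <= f z) -> (forall z, 0 <= g z) ->
  average (fun z => f z + g z) x = average f x + average g x.
Proof.
move=> f0 g0; have p0 z : 0 <= (p x z)%:E by rewrite lee_fin; exact: hp.1.
rewrite /average -esumD//; try by move=> z _; rewrite mule_ge0.
by apply: eq_esum => z _; rewrite ge0_muleDr.
Qed.

Lemma averageZl (c : R) f x : (0 <= c)%R -> (forall z, 0 <= f z) ->
  average (fun z => c%:E * f z) x = c%:E * average f x.
Proof.
move=> c0 f0; rewrite /average -ge0_esumZl//; last first.
  by move=> z; rewrite mule_ge0// lee_fin; exact: hp.1.
by apply: eq_esum => z _; rewrite muleCA.
Qed.

Lemma average_sum I (r : seq I) (f : I -> X -> \bar R) x :
  (forall i z, 0 <= f i z) ->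
  average (fun z => \sum_(i <- r) f i z) x = \sum_(i <- r) average (f i) x.
Proof.
elim: r => [|i r IH] f0.
  rewrite big_nil /average esum1// => z _; by rewrite big_nil mule0.
rewrite big_cons -IH// -averageD//; last by move=> z; exact: sume_ge0.
by apply: eq_average => z; rewrite big_cons.
Qed.

Lemma average_nneseries (f : nat -> X -> \bar R) x :
  (forall n z, 0 <= f n z) ->
  average (fun z => \sum_(0 <= n <oo) f n z) x =
  \sum_(0 <= n <oo) average (f n) x.
Proof.
move=> f0; have p0 z : (0 <= p x z)%R by exact: hp.1.
rewrite /average -esum_nneseries//; last first.
  by move=> z n; rewrite mule_ge0// lee_fin.
by apply: eq_esum => z _; rewrite nneseriesZl.
Qed.

Lemma average_cst (c : R) x : (0 <= c)%R -> average (fun=> c%:E) x = c%:E.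
Proof.
move=> c0; rewrite (@eq_average _ (fun=> c%:E * 1)); last by move=> z; rewrite mule1.
rewrite averageZl// /average; under eq_esum do rewrite mule1.
by rewrite hp.2 mule1.
Qed.

Lemma step_prob_ge0 n x y : 0 <= step_prob p n x y.
Proof.
elim: n x => [|n IH] x /=; first by rewrite lee_fin.
exact: average_ge0.
Qed.

Lemma step_probS n x y :
  step_prob p n.+1 x y = average (fun z => step_prob p n z y) x.
Proof. by []. Qed.

Definition green (x y : X) : \bar R := \sum_(0 <= n <oo) step_prob p n x y.

Lemma green_ge0 x y : 0 <= green x y.
Proof. by apply: nneseries_ge0 => n _ _; exact: step_prob_ge0. Qed.

Lemma green_rec x y :
  green x y = ((x == y)%:R)%:E + average (fun z => green z y) x.
Proof.
rewrite /green nneseries_recl//; last by move=> n _; exact: step_prob_ge0.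
congr (_ + _); rewrite average_nneseries//; last first.
  by move=> n z; exact: step_prob_ge0.
rewrite -(@nneseries_addn _ (fun n => step_prob p n x y) 1); last first.
  by move=> n; exact: step_prob_ge0.
by apply: eq_eseriesr => n _; rewrite addn1.
Qed.

(** Expectation of [f] at time [n] for the chain killed when it enters [B] at
    a positive time; the starting point itself may lie in [B]. *)
Fixpoint taboo B (n : nat) f (x : X) : \bar R :=
  if n is m.+1 then average (fun z => if z \in B then 0 else taboo B m f z) x
  else f x.

Lemma taboo_ge0 B n f x : (forall z, 0 <= f z) -> 0 <= taboo B n f x.
Proof.
move=> f0; elim: n x => [|n IH] x //=.
by apply: average_ge0 => z; case: ifP.
Qed.

Lemma le_taboo B n f g x : (forall z, f z <= g z) ->
  taboo B n f x <= taboo B n g x.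
Proof.
move=> fg; elim: n x => [|n IH] x //=.
by move=> /=; apply: le_average => z; case: ifP => // _; exact: IH.
Qed.

Lemma tabooZl B n (c : R) f x : (0 <= c)%R -> (forall z, 0 <= f z) ->
  taboo B n (fun z => c%:E * f z) x = c%:E * taboo B n f x.
Proof.
move=> c0 f0; elim: n x => [|n IH] x //=.
rewrite -averageZl//; last by move=> z; case: ifP => // _; exact: taboo_ge0.
by apply: eq_average => z; case: ifP; rewrite ?mule0.
Qed.

(** Killing only lowers an average that is already at most [f]; this
    monotonicity is what gives the killed averages a limit. *)
Lemma taboo_nonincreasing B f x : (forall z, 0 <= f z) ->
  (forall z, average f z <= f z) ->
  {homo (fun n => taboo B n f x) : m n / (m <= n)%N >-> n <= m}.
Proof.
move=> f0 exc; apply/nonincreasing_seqP => n; elim: n x => [|n IH] x.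
  apply: le_trans (exc x) => /=; apply: le_average => z; by case: ifP.
by move=> /=; apply: le_average => z; case: ifP => // _; exact: IH.
Qed.

(** Expectation of [psi] at the last visit to [B] up to time [N], times [f] at
    time [N]: the index [n] is the time of that visit and [y] its place, after
    which the chain has to avoid [B] during [N - n] steps. *)
Definition last_visit_sum B f (psi : X -> R) (N : nat) (x : X) : \bar R :=
  \sum_(0 <= n < N.+1) \sum_(y <- B)
     step_prob p n x y * ((psi y)%:E * taboo B (N - n) f y).

Lemma taboo_le B n f (M : R) x : (0 <= M)%R -> (forall z, f z <= M%:E) ->
  taboo B n f x <= M%:E.
Proof.
move=> M0 fM; elim: n x => [|n IH] x //=.
rewrite -(average_cst x M0); apply: le_average => z.
by case: ifP; rewrite ?lee_fin.
Qed.

Lemma sum_step_prob0 B (a : X -> \bar R) x : uniq B ->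
  \sum_(y <- B) step_prob p 0 x y * a y = if x \in B then a x else 0.
Proof.
move=> uB /=; case: ifPn => xB.
  rewrite (bigD1_seq x)//= eqxx mul1e big1 ?adde0// => y yx.
  by rewrite eq_sym (negbTE yx) mul0e.
rewrite big1_seq// => y /= yB; case: eqP => [xy|_]; last by rewrite mul0e.
by move: xB; rewrite xy yB.
Qed.

(** First-step analysis: the term [n = 0] covers the paths which do not come
    back to [B] up to time [N.+1]; on the others the last visit is that of the path started
    at the first step.  The bound on [f] keeps the weights finite, so that they
    can be moved across the average. *)
Lemma last_visit_sumS B f (M : R) psi N x : uniq B ->
  (forall z, 0 <= f z <= M%:E) -> (forall z, 0 <= psi z)%R ->
  last_visit_sum B f psi N.+1 x =
  (if x \in B then (psi x)%:E * taboo B N.+1 f x else 0) +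
  average (last_visit_sum B f psi N) x.
Proof.
move=> uB fM psi0.
have f0 z : 0 <= f z by have /andP[] := fM z.
have M0 : (0 <= M)%R.
  by rewrite -lee_fin; have /andP[] := fM x; exact: le_trans.
have t0 n y : 0 <= (psi y)%:E * taboo B n f y.
  by rewrite mule_ge0 ?lee_fin// taboo_ge0.
have tfin n y : (psi y)%:E * taboo B n f y \is a fin_num.
  rewrite fin_numM// ge0_fin_numE; last exact: taboo_ge0.
  rewrite (@le_lt_trans _ _ M%:E) ?ltry// taboo_le// => z.
  by have /andP[] := fM z.
rewrite {1}/last_visit_sum big_nat_recl// subn0; congr (_ + _).
  exact: sum_step_prob0.
rewrite /last_visit_sum average_sum; last first.
  move=> n z; apply: sume_ge0 => y _; rewrite mule_ge0//; exact: step_prob_ge0.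
apply: eq_bigr => n _; rewrite subSS average_sum; last first.
  by move=> y z; rewrite mule_ge0//; exact: step_prob_ge0.
apply: eq_bigr => y _; rewrite step_probS muleC.
have := t0 (N - n)%N y; rewrite -(fineK (tfin (N - n)%N y)) lee_fin => r0.
rewrite -averageZl//; last by move=> z; exact: step_prob_ge0.
by apply: eq_average => z; rewrite muleC.
Qed.

Lemma last_visit_sum_ge0 B f psi N x :
  (forall z, 0 <= f z) -> (forall z, 0 <= psi z)%R ->
  0 <= last_visit_sum B f psi N x.
Proof.
move=> f0 psi0; apply: sume_ge0 => n _; apply: sume_ge0 => y _.
by rewrite !mule_ge0 ?lee_fin ?step_prob_ge0 ?taboo_ge0.
Qed.

(** For a harmonic [f] the expectation of [f] at time [N] is [f x], and the two
    terms split it according to whether [B] is visited up to time [N]. *)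
Lemma last_visit_sum_harmonic B f (M : R) N x : uniq B ->
  (forall z, 0 <= f z <= M%:E) -> (forall z, average f z = f z) ->
  last_visit_sum B f (fun=> 1%R) N x +
    (if x \in B then 0 else taboo B N f x) = f x.
Proof.
move=> uB fM har; have f0 z : 0 <= f z by have /andP[] := fM z.
elim: N x => [|N IH] x.
  rewrite /last_visit_sum big_nat1 sum_step_prob0//=.
  by case: ifP => _; rewrite ?mul1e ?adde0 ?add0e.
rewrite (last_visit_sumS _ _ uB fM)//.
transitivity (taboo B N.+1 f x + average (last_visit_sum B f (fun=> 1%R) N) x).
  by case: ifP => _; rewrite ?mul1e ?adde0// add0e addeC.
rewrite /= -averageD; last 2 first.
- by move=> z; case: ifP => // _; exact: taboo_ge0.
- by move=> z; exact: last_visit_sum_ge0.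
rewrite -[RHS]har; apply: eq_average => z; rewrite -[RHS]IH addeC.
by [].
Qed.

End Average.

(** * The Markov property for functions of finitely many steps *)

Section Enumeration.

(** Countable additivity is available along [nat]; the pair [f], [g] transports
    it to the state space, whether finite or infinite. *)
Lemma countable_enumeration (X : pointedType) : countable [set: X] ->
  exists (f : X -> nat) (g : nat -> X), cancel f g.
Proof.
move=> /countable_injP[f finj]; exists f, (fun n => xget point [set x | f x = n]).
move=> x; apply: finj; rewrite ?in_setT//.
by have /= := @xgetI _ point [set y | f y = f x] x erefl.
Qed.

Lemma esum_enumeration (R : realType) (X : pointedType) (f : X -> nat)
    (g : nat -> X) (a : X -> \bar R) : cancel f g -> (forall x, 0 <= a x)%E ->
  (\esum_(x in [set: X]) a x =
   \sum_(0 <= n <oo) if f (g n) == n then a (g n) else 0)%E.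
Proof.
move=> fK a0; rewrite nneseries_esumT; last by move=> n; case: ifP.
transitivity (\esum_(n in f @` [set: X]) a (g n))%E.
  rewrite esum_image; first by apply: eq_esum => x _; rewrite fK.
  by move=> x y _ _ /(congr1 g); rewrite !fK.
rewrite esum_mkcond; apply: eq_esum => n _.
congr (if _ then _ else _); apply/idP/eqP.
  by rewrite inE => -[x _ <-]; rewrite fK.
by move=> fgn; rewrite inE; exists (g n).
Qed.

End Enumeration.

Section MarkovProperty.
Context (R : realType) d (X : measurableType d) (hX : countable_discrete X)
  (p : X -> X -> R) (hp : markov_operator p)
  d' (Omega : measurableType d') (Pr : X -> probability Omega R)
  (Z : nat -> {mfun Omega >-> X}) (hZ : markov_chain p Pr Z).

Lemma measurable_fun_discrete d2 (Y : measurableType d2) (f : X -> Y) :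
  measurable_fun [set: X] f.
Proof. by move=> _ B mB; exact: hX.2. Qed.

Definition trajectory (m n : nat) (w : Omega) : seq X :=
  [seq Z i w | i <- iota m n].

(** The state space is countable, so one may condition on the values of the
    coordinates one after the other. *)
Lemma measurable_trajectory d2 (Y : measurableType d2) (F : seq X -> Y) m n :
  measurable_fun [set: Omega] (fun w => F (trajectory m n w)).
Proof.
elim: n m F => [|n IH] m F; first by apply: (measurable_cst (F [::])).
move=> _ B mB; rewrite setTI.
rewrite (_ : _ @^-1` B = \bigcup_(z in [set: X])
    (Z m @^-1` [set z] `&`
     (fun w => F (z :: trajectory m.+1 n w)) @^-1` B)); last first.
  apply/seteqP; split=> [w /= Bw|w [z _ [/= Zw Bw]]]; first by exists (Z m w).
  by rewrite /= /trajectory /= Zw.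
apply: countable_bigcupT_measurable; first exact: hX.1.
move=> z; apply: measurableI.
  by rewrite -[X in measurable X]setTI; apply: measurable_funP => //; exact: hX.2.
rewrite -[X in measurable X]setTI.
exact: (IH m.+1 (fun s => F (z :: s))).
Qed.

Definition cylinder (m : nat) (s : nat -> X) : set Omega :=
  [set w | forall i, (i <= m)%N -> Z i w = s i].

Lemma measurable_cylinder m s : measurable (cylinder m s).
Proof.
rewrite (_ : cylinder m s =
    (fun w => trajectory 0 m.+1 w == mkseq s m.+1) @^-1` [set true]); last first.
  apply/seteqP; split=> w /=.
    move=> ws; apply/eqP/eq_in_map => i; rewrite mem_iota /= add0n => im.
    exact: ws.
  move=> /eqP/eq_in_map ws i im; apply: ws.
  by rewrite mem_iota add0n.
rewrite -[X in measurable X]setTI.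
exact: (measurable_trajectory (fun t => t == mkseq s m.+1)).
Qed.

Local Open Scope ereal_scope.

(** Expectation of a function of the next [n] states, computed by first-step
    analysis and hence with no reference to the underlying probability space. *)
Fixpoint path_average (n : nat) (F : seq X -> \bar R) (x : X) : \bar R :=
  if n is m.+1 then average p (fun z => path_average m (fun s => F (z :: s)) z) x
  else F [::].

Lemma path_average_ge0 n F x : (forall s, 0 <= F s) -> 0 <= path_average n F x.
Proof.
elim: n F x => [|n IH] F x F0 //=.
by apply: average_ge0 => // z; exact: IH.
Qed.

(** The chain is only known through the probabilities of cylinders and
    there is no shift on [Omega], so the induction on [n] fixes one more
    coordinate at each step, hence the quantification over the cylinder. *)
Lemma markov_property x m s n (F : seq X -> \bar R) : (forall t, 0 <= F t) ->
  \int[Pr x]_(w in cylinder m s) F (trajectory m.+1 n w) =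
  Pr x (cylinder m s) * path_average n F (s m).
Proof.
elim: n m s F => [|n IH] m s F F0.
  by rewrite /= muleC -(integral_cst (Pr x) (measurable_cylinder m s)).
have [f [g fK]] := countable_enumeration hX.1.
pose ext z i := if i == m.+1 then z else s i.
pose E k := if f (g k) == k then cylinder m.+1 (ext (g k)) else set0.
have mE k : measurable (E k).
  by rewrite /E; case: ifP => // _; exact: measurable_cylinder.
have extE z w : cylinder m.+1 (ext z) w <-> cylinder m s w /\ Z m.+1 w = z.
  split=> [sw|[sw Zw] i].
    split=> [i im|]; last by rewrite sw// /ext eqxx.
    by rewrite sw ?(leq_trans im)// /ext ltn_eqF.
  by rewrite leq_eqVlt ltnS /ext => /orP[/eqP ->|im]; rewrite ?eqxx ?ltn_eqF// sw.
(* A cylinder is cut according to the next state [g k]. *)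
have UE : cylinder m s = \bigcup_k E k.
  apply/seteqP; split=> [w sw|w [k _]].
    by exists (f (Z m.+1 w)) => //; rewrite /E fK eqxx; apply/extE.
  by rewrite /E; case: ifP => // _ /extE[].
have tE : trivIset setT E.
  move=> k l _ _ [w []]; rewrite /E.
  case: ifP => [/eqP fgk /extE[_ Zk]|//]; case: ifP => [/eqP fgl /extE[_ Zl]|//].
  by rewrite -fgk -fgl -Zk -Zl.
rewrite UE ge0_integral_bigcup//; last first.
  apply: (@measurable_funS _ _ _ _ setT) => //.
  exact: measurable_trajectory.
rewrite -UE /= /average (esum_enumeration fK); last first.
  by move=> z; rewrite mule_ge0 ?lee_fin ?hp.1// path_average_ge0.
have cfin : Pr x (cylinder m s) \is a fin_num.
  by apply: fin_num_measure; exact: measurable_cylinder.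
rewrite -[X in X * _](fineK cfin) -nneseriesZl; last first.
  by move=> k _; case: ifP => // _; rewrite mule_ge0 ?lee_fin ?hp.1// path_average_ge0.
apply: eq_eseriesr => k _; rewrite /E; case: ifPn => fgk; last first.
  by rewrite integral_set0 mule0.
transitivity (\int[Pr x]_(w in cylinder m.+1 (ext (g k)))
    F (g k :: trajectory m.+2 n w)).
  apply: eq_integral => w; rewrite inE => /extE[_ Zw].
  by rewrite /trajectory /= Zw.
rewrite fineK// (IH m.+1 (ext (g k)) (fun t => F (g k :: t)))// /ext eqxx muleA.
congr (_ * _); rewrite [in LHS]/cylinder [in RHS]/cylinder hZ hZ -EFinM.
congr EFin; rewrite big_ord_recr/= ltn_eqF// eqxx mulrA.
congr (_ * _ * _)%R.
by apply: eq_bigr => i _; rewrite !ltn_eqF ?ltnS// ltnW.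
Qed.

Lemma start_prob x : Pr x (cylinder 0 (fun=> x)) = 1.
Proof. by rewrite /cylinder hZ eqxx big_ord0 mulr1. Qed.

Lemma path_expectation x n (F : seq X -> \bar R) : (forall t, 0 <= F t) ->
  \int[Pr x]_w F (trajectory 0 n.+1 w) =
  path_average n (fun t => F (x :: t)) x.
Proof.
move=> F0; have mC := measurable_cylinder 0 (fun=> x).
rewrite -[RHS]mul1e -(start_prob x) -(markov_property x 0 (fun=> x))//.
transitivity (\int[Pr x]_(w in cylinder 0 (fun=> x)) F (trajectory 0 n.+1 w)).
  rewrite (@ge0_negligible_integral _ _ _ (Pr x) setT (~` cylinder 0 (fun=> x)))//.
  - by rewrite setTD setCK.
  - exact: measurableC.
  - exact: measurable_trajectory.
  - by have := probability_setC (Pr x) mC; rewrite start_prob subee.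
apply: eq_integral => w; rewrite inE => /(_ 0%N isT) Z0.
by rewrite /trajectory /= Z0.
Qed.

Lemma path_average_cst n (c : R) x : (0 <= c)%R ->
  path_average n (fun=> c%:E) x = c%:E.
Proof.
move=> c0; elim: n x => [|n IH] x //=.
by rewrite -[RHS](average_cst hp x c0); apply: eq_average => z; rewrite IH.
Qed.

Lemma eq_path_average n F G x : (forall s, F s = G s) ->
  path_average n F x = path_average n G x.
Proof. by move=> FG; congr path_average; apply/funext. Qed.

End MarkovProperty.

(** * Hitting probabilities and the Green function *)

Section Hitting.
Context (R : realType) d (X : measurableType d) (hX : countable_discrete X)
  (p : X -> X -> R) (hp : markov_operator p)
  d' (Omega : measurableType d') (Pr : X -> probability Omega R)
  (Z : nat -> {mfun Omega >-> X}) (hZ : markov_chain p Pr Z).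
Local Open Scope ereal_scope.

Definition visits (y : X) (s : seq X) : R := (y \in s)%:R.

Definition hit_by (y : X) (N : nat) (x : X) : \bar R :=
  path_average p N (fun s => (visits y (x :: s))%:E) x.

Lemma hit_by_ge0 y N x : 0 <= hit_by y N x.
Proof. by apply: path_average_ge0 => // s; rewrite lee_fin. Qed.

Lemma hit_by_self y N : hit_by y N y = 1.
Proof.
rewrite /hit_by -[RHS](path_average_cst hp N y ler01).
by apply: eq_path_average => s; rewrite /visits inE eqxx.
Qed.

Lemma hit_byS y N x : x != y -> hit_by y N.+1 x = average p (hit_by y N) x.
Proof.
move=> xy; apply: eq_average => z; apply: eq_path_average => s.
by rewrite /visits [in LHS]inE eq_sym (negbTE xy).
Qed.

(** Both sides satisfy the same equation off [y] and agree at [y], where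
    [hit_by] is 1.  Here the Green function, being a solution, dominates the
    iterates started from the smaller datum 0. *)
Lemma hit_by_green N x y : green p y y \is a fin_num ->
  hit_by y N x * green p y y <= green p x y.
Proof.
move=> gfin; have [->|xy] := eqVneq x y; first by rewrite hit_by_self mul1e.
elim: N x xy => [|N IH] x xy.
  rewrite /hit_by /= /visits inE eq_sym (negbTE xy) mul0e; exact: green_ge0.
rewrite hit_byS// (green_rec hp x y) (negbTE xy) add0e -(fineK gfin) muleC.
rewrite -averageZl//; [|exact/fine_ge0/green_ge0|by move=> z; exact: hit_by_ge0].
apply: le_average => // z; rewrite fineK// muleC.
by have [->|/IH//] := eqVneq z y; rewrite hit_by_self mul1e.
Qed.

(** The converse comparison, with the iterates of the Green function on the
    left: up to time [N] the visits to [y] can only start after [y] has been hit. *)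
Lemma green_partial_hit_by N x y : green p y y \is a fin_num ->
  \sum_(0 <= n < N.+1) step_prob p n x y <= hit_by y N x * green p y y.
Proof.
move=> gfin; have leg M : \sum_(0 <= n < M) step_prob p n y y <= green p y y.
  by apply: nneseries_lim_ge => n _ _; exact: step_prob_ge0.
have [->|xy] := eqVneq x y; first by rewrite hit_by_self mul1e.
elim: N x xy => [|N IH] x xy.
  rewrite big_nat1 /= (negbTE xy) mule_ge0//; [exact: hit_by_ge0|exact: green_ge0].
rewrite hit_byS// big_nat_recl//= (negbTE xy) add0e.
rewrite -[X in X <= _](@average_sum _ _ _ hp); last first.
  by move=> n z; exact: step_prob_ge0.
rewrite -(fineK gfin) muleC -averageZl//;
  [|exact/fine_ge0/green_ge0|by move=> z; exact: hit_by_ge0].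
apply: le_average => // z; rewrite fineK// muleC.
have [->|/IH//] := eqVneq z y; by rewrite hit_by_self mul1e.
Qed.

Lemma measurable_visit n y : measurable [set w | Z n w = y].
Proof. exact: (measurable_funPTI (Z n) (hX.2 [set y])). Qed.

Lemma prob_hit_by x y N :
  Pr x (\bigcup_(n in `I_N.+1) [set w | Z n w = y]) = hit_by y N x.
Proof.
rewrite -[RHS](path_expectation hX hp hZ x N (F := fun s => (visits y s)%:E));
  last by move=> s; rewrite lee_fin.
rewrite -[X in Pr x X]setIT -integral_indic//; last first.
  by apply: bigcup_measurable => n _; exact: measurable_visit.
apply: eq_integral => w _; rewrite indicE /visits; congr ((_ : bool)%:R%:E).
apply/idP/mapP => [|[n]].
  rewrite inE => -[n /= nN <-]; exists n => //.
  by rewrite -[_ :: _]/(iota 0 N.+1) mem_iota.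
by rewrite mem_iota inE => /= nN ->; exists n.
Qed.

Lemma hitting_prob_cvg x y :
  hit_by y N x @[N --> \oo] --> (hitting_prob Pr Z x y)%:E.
Proof.
rewrite /hitting_prob fineK; last first.
  apply: fin_num_measure; rewrite (_ : mkset _ = \bigcup_n [set w | Z n w = y]).
    by apply: bigcupT_measurable => n; exact: measurable_visit.
  by apply/seteqP; split=> [w [n ?]|w [n _ ?]]; exists n.
rewrite (_ : [set w | _] =
    \bigcup_N \bigcup_(n in `I_N.+1) [set w | Z n w = y]); last first.
  apply/seteqP; split=> [w [n ?]|w [N _ [n _ ?]]]; last by exists n.
  by exists n => //; exists n => /=.
rewrite (_ : (fun N => hit_by y N x) =
  Pr x \o (fun N => \bigcup_(n in `I_N.+1) [set w | Z n w = y])); last first.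
  by apply/funext => N; rewrite /= prob_hit_by.
apply: nondecreasing_cvg_mu.
- by move=> N; apply: bigcup_measurable => n _; exact: measurable_visit.
- by apply: bigcupT_measurable => N; apply: bigcup_measurable => n _;
    exact: measurable_visit.
- move=> N M NM; apply/subsetPset => w [n /= nN ?]; exists n => //=.
  exact: leq_trans nN _.
Qed.

(** The identity [G(x, y) = F(x, y) * G(y, y)], obtained by letting [N] tend to
    infinity in the two preceding comparisons; this avoids the
    decomposition according to the hitting time. *)
Lemma green_hitting x y : green p y y \is a fin_num ->
  green p x y = (hitting_prob Pr Z x y)%:E * green p y y.
Proof.
move=> gfin.
have cH : hit_by y N x * green p y y @[N --> \oo] -->
    (hitting_prob Pr Z x y)%:E * green p y y.
  by apply: cvgeZr => //; exact: hitting_prob_cvg.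
have cG : \sum_(0 <= n < N.+1) step_prob p n x y @[N --> \oo] --> green p x y.
  rewrite (cvg_shiftS (fun N => \sum_(0 <= n < N) step_prob p n x y)).
  by apply: is_cvg_nneseries => n _ _; exact: step_prob_ge0.
apply/eqP; rewrite eq_le; apply/andP; split.
  apply: (lee_cvg_to cG cH).
  by apply: nearW => N; exact: green_partial_hit_by.
by apply: (cvge_to_le cH); apply: nearW => N; exact: hit_by_green.
Qed.

End Hitting.

(** * Last visits to a finite set *)

Section Convolution.
Context (R : realType).
Implicit Types (u v : R^nat).

(** The sum is squeezed by cutting it at [N./2]: for [n] below the cut,
    [V <= v (N - n) <= v N./2], and above it the terms are controlled by the
    tail of the convergent series of [u]. *)
Lemma nonincreasing_convolution_cvg u v (U V : R) :
  (forall n, 0 <= u n) -> (forall n, 0 <= v n) ->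
  {homo v : m n / (m <= n)%N >-> n <= m} ->
  series u @ \oo --> U -> v @ \oo --> V ->
  \sum_(0 <= n < N.+1) u n * v (N - n)%N @[N --> \oo] --> U * V.
Proof.
move=> u0 v0 vdec cu cv.
have half : (fun N : nat => N./2) @ \oo --> \oo.
  move=> A [n _ nA]; exists n.*2 => // N /= nN; apply: nA => /=.
  by rewrite -[n]doubleK half_leq.
have cS : series u n.+1 @[n --> \oo] --> U by rewrite (cvg_shiftS (series u)).
have Sdec : {homo series u : m n / (m <= n)%N >-> m <= n}.
  by apply/nondecreasing_seqP => n; rewrite /series /= big_nat_recr//= lerDl.
have SU n : series u n <= U.
  rewrite -(cvg_lim _ cu)//; apply: nondecreasing_cvgn_le => //; exact: cvgP cu.
have Vv n : V <= v n.
  rewrite -(cvg_lim _ cv)//; apply: nonincreasing_cvgn_ge => //; exact: cvgP cv.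
apply: (@squeeze_cvgr _ _ _ _ (fun N => series u N.+1 * V)
   (fun N => U * v N./2 + (U - series u N./2.+1) * v 0%N)).
- apply: nearW => N; apply/andP; split.
    by rewrite /series /= mulr_suml; apply: ler_sum_nat => n _; exact: ler_wpM2l.
  have hN : (N./2.+1 <= N.+1)%N by rewrite ltnS -[leqRHS]doubleK half_leq// -addnn leq_addr.
  rewrite (@big_cat_nat _ _ _ N./2.+1)//=; apply: lerD.
    apply: (@le_trans _ _ (series u N./2.+1 * v N./2)); last exact: ler_wpM2r.
    rewrite /series /= mulr_suml; apply: ler_sum_nat => n /andP[_ nN].
    apply: ler_wpM2l => //; apply: vdec.
    apply: leq_trans (leq_sub2l N (nN : (n <= N./2)%N)).
    by rewrite -{2}(odd_double_half N) -addnn addnA addnK leq_addl.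
  apply: (@le_trans _ _ ((series u N.+1 - series u N./2.+1) * v 0%N)).
    rewrite /series /= (@big_cat_nat _ _ _ N./2.+1 0%N N.+1)//= addrAC subrr add0r mulr_suml.
    by apply: ler_sum_nat => n _; apply: ler_wpM2l => //; exact: vdec.
  by apply: ler_wpM2r => //; rewrite lerB.
- apply: cvgMr_tmp; exact: cS.
- rewrite -[X in _ --> X]addr0 -[X in _ + X](mul0r (v 0%N)) -(subrr U).
  apply: cvgD.
    by apply: cvgMl_tmp; exact: (cvg_comp _ _ half cv).
  apply: cvgMr_tmp; apply: cvgB; first exact: cvg_cst.
  exact: (cvg_comp _ _ half cS).
Qed.

End Convolution.

Section LastVisit.
Context (R : realType) d (X : measurableType d) (hX : countable_discrete X)
  (p : X -> X -> R) (hp : markov_operator p) (htrans : transient p)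
  d' (Omega : measurableType d') (Pr : X -> probability Omega R)
  (Z : nat -> {mfun Omega >-> X}) (hZ : markov_chain p Pr Z).
Implicit Types (B : seq X) (phi : X -> R).

(** The value of [phi] at the last entry of the path that lies in [B], or [a]
    if there is none. *)
Definition last_value B phi (a : R) (s : seq X) : R :=
  foldl (fun b z => if z \in B then phi z else b) a s.

Lemma last_valueP B phi a s :
  last_value B phi a s = a \/ exists2 z, z \in s & last_value B phi a s = phi z.
Proof.
elim: s a => [|z s IH] a /=; first by left.
have [->|[y ys ->]] := IH (if z \in B then phi z else a).
  by case: ifP => _; [right; exists z; rewrite ?mem_head|left].
by right; exists y => //; rewrite inE ys orbT.
Qed.

Lemma last_value_ge0 B phi a s : (forall z, 0 <= phi z) -> 0 <= a ->
  0 <= last_value B phi a s.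
Proof. by move=> phi0 a0; have [->|[z _ ->]] := last_valueP B phi a s. Qed.

(** This is what pushes the last visit towards infinity: a visit to [B] at
    time [i] forces the last one to happen not before [i]. *)
Lemma last_value_trajectory B phi a i N w : (i <= N)%N -> Z i w \in B ->
  exists2 n, (i <= n)%N &
    last_value B phi a (trajectory Z 0 N.+1 w) = phi (Z n w).
Proof.
move=> iN ZB; rewrite /trajectory -(subnKC iN) -addnS iotaD map_cat add0n /=.
rewrite /last_value foldl_cat /= ZB -/(last_value _ _ _ _).
have [->|[z /mapP[n]]] := last_valueP B phi (phi (Z i w)) [seq Z j w | j <- iota i.+1 (N - i)].
  by exists i.
by rewrite mem_iota => /andP[/ltnW ni _] -> ->; exists n.
Qed.

Local Open Scope ereal_scope.

(** The contribution to [last_visit_sum] of the last visits at a positive time. *)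
Definition later_visit_sum B phi (N : nat) (x : X) : \bar R :=
  if N is M.+1 then average p (last_visit_sum p B (fun=> 1) phi M) x else 0.

Lemma last_visit_sumE B phi N x : uniq B -> (forall z, 0 <= phi z)%R ->
  last_visit_sum p B (fun=> 1) phi N x =
  (if x \in B then (phi x)%:E * taboo p B N (fun=> 1) x else 0) +
  later_visit_sum B phi N x.
Proof.
move=> uB phi0; case: N => [|N]; last first.
  by apply: (last_visit_sumS hp (M := 1)) => // z; rewrite lee01 lexx.
by rewrite /last_visit_sum big_nat1 sum_step_prob0//= adde0.
Qed.

(** The default [a] survives exactly when [B] is avoided at all positive times;
    letting it vary is what makes the induction on [N] go through, since a
    visit to [B] replaces it by a value of [phi]. *)
Lemma path_average_last_value B phi a N x : uniq B ->
  (forall z, 0 <= phi z)%R -> (0 <= a)%R ->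
  path_average p N (fun s => (last_value B phi a s)%:E) x =
  a%:E * taboo p B N (fun=> 1) x + later_visit_sum B phi N x.
Proof.
move=> uB phi0; elim: N a x => [|N IH] a x a0; first by rewrite /= mule1 adde0.
have t0 n z : 0 <= taboo p B n (fun=> 1) z by apply: taboo_ge0.
rewrite /= -averageZl//; last by move=> z; case: ifP.
rewrite -averageD//; last 2 first.
- by move=> z; case: ifP; rewrite ?mule0// mule_ge0.
- by move=> z; exact: last_visit_sum_ge0.
apply: eq_average => z; rewrite IH; last by case: ifP.
rewrite last_visit_sumE//; case: ifP => _; first by rewrite mule0 add0e.
by rewrite add0e.
Qed.

Lemma last_value_expectation B phi N x : uniq B -> (forall z, 0 <= phi z)%R ->
  \int[Pr x]_w (last_value B phi 0 (trajectory Z 0 N.+1 w))%:E =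
  last_visit_sum p B (fun=> 1) phi N x.
Proof.
move=> uB phi0.
rewrite (path_expectation hX hp hZ x N
  (F := fun s => (last_value B phi 0 s)%:E)); last first.
  by move=> s; rewrite lee_fin last_value_ge0.
rewrite last_visit_sumE// /= path_average_last_value//; last by case: ifP.
by case: ifP => _; rewrite ?mul0e.
Qed.

End LastVisit.

Section LastVisitLimit.
Context (R : realType) (X : choiceType)
  (p : X -> X -> R) (hp : markov_operator p) (htrans : transient p).
Implicit Types (B : seq X) (phi h : X -> R).

Definition greenR (x y : X) : R := fine (green p x y).

Lemma green_fin x y : green p x y \is a fin_num.
Proof. by rewrite ge0_fin_numE ?htrans// green_ge0. Qed.

Lemma greenR_ge0 x y : 0 <= greenR x y.
Proof. by apply: fine_ge0; exact: green_ge0. Qed.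

Definition tabooR B n h (y : X) : R :=
  fine (taboo p B n (EFin \o h) y).

(** For [h] excessive, the limit of the averages of [h] over the paths which
    do not return to [B]; for [h = 1] it is the probability of
    never returning to [B], known as the escape probability. *)
Definition residual B h (y : X) : R := limn (fun n => tabooR B n h y).

Definition bounded_excessive h (M : R) :=
  (forall z, 0 <= h z <= M) /\ forall z, (average p (EFin \o h) z <= (h z)%:E)%E.

Lemma bounded_excessive1 : bounded_excessive (fun=> 1) 1.
Proof.
split=> z; first by rewrite ler01 lexx.
by rewrite average_cst.
Qed.

Section Excessive.
Context (h : X -> R) (M : R) (hM : bounded_excessive h M).

Lemma excessive_bound_ge0 (x : X) : 0 <= M.
Proof. by have /andP[] := hM.1 x; exact: le_trans. Qed.

Lemma EFin_tabooR B n y : (tabooR B n h y)%:E = taboo p B n (EFin \o h) y.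
Proof.
rewrite /tabooR fineK// ge0_fin_numE; last first.
  by apply: taboo_ge0 => // z; rewrite lee_fin; have /andP[] := hM.1 z.
apply: (@le_lt_trans _ _ M%:E); last exact: ltry.
apply: taboo_le => //; first exact: (excessive_bound_ge0 y).
by move=> z; rewrite lee_fin; have /andP[] := hM.1 z.
Qed.

Lemma tabooR_ge0 B n y : 0 <= tabooR B n h y.
Proof.
by apply/fine_ge0/taboo_ge0 => // z; rewrite lee_fin; have /andP[] := hM.1 z.
Qed.

Lemma tabooR_nonincreasing B y :
  {homo (fun n => tabooR B n h y) : m n / (m <= n)%N >-> n <= m}.
Proof.
move=> m n mn; rewrite -lee_fin !EFin_tabooR.
apply: taboo_nonincreasing => //; last exact: hM.2.
by move=> z; rewrite lee_fin; have /andP[] := hM.1 z.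
Qed.

Lemma residual_cvg B y : tabooR B n h y @[n --> \oo] --> residual B h y.
Proof.
apply: nonincreasing_is_cvgn; first exact: tabooR_nonincreasing.
by exists 0 => _ [n _ <-]; exact: tabooR_ge0.
Qed.

Lemma residual_ge0 B y : 0 <= residual B h y.
Proof.
apply: (cvgr_to_ge (@residual_cvg B y)).
by apply: nearW => n; exact: tabooR_ge0.
Qed.

(** The real form of [last_visit_sum], with the sum over the times inside, so
    that each state contributes a convolution. *)
Definition last_visit_sumR B phi N x : R :=
  \sum_(y <- B) (\sum_(0 <= n < N.+1)
    fine (step_prob p n x y) * tabooR B (N - n) h y) * phi y.

Lemma step_prob_fin n x y : step_prob p n x y \is a fin_num.
Proof.
rewrite ge0_fin_numE ?step_prob_ge0//; apply: le_lt_trans (htrans x y).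
have := @nneseries_lim_ge R (fun n => step_prob p n x y) xpredT 0 n.+1.
move=> /(_ (fun n _ _ => step_prob_ge0 hp n x y)); apply: le_trans.
rewrite big_nat_recr//= leeDr// sume_ge0// => i _; exact: step_prob_ge0.
Qed.

Lemma EFin_last_visit_sumR B phi N x :
  (last_visit_sumR B phi N x)%:E = last_visit_sum p B (EFin \o h) phi N x.
Proof.
rewrite /last_visit_sumR /last_visit_sum [RHS]exchange_big/= -sumEFin.
apply: eq_bigr => y _; rewrite mulr_suml -sumEFin; apply: eq_bigr => n _.
rewrite -mulrA [X in _ * X]mulrC !EFinM fineK ?step_prob_fin//.
by rewrite EFin_tabooR.
Qed.

(** Transience makes the series of the [step_prob p n x y] converge to the Green
    function, and the killed averages decrease to the residual. *)
Lemma last_visit_sumR_cvg B phi x :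
  last_visit_sumR B phi N x @[N --> \oo] -->
  \sum_(y <- B) greenR x y * residual B h y * phi y.
Proof.
rewrite /last_visit_sumR; apply: cvg_big => [|y _]; first exact: add_continuous.
 apply: cvgMr_tmp.
apply: (@nonincreasing_convolution_cvg _ (fun n => fine (step_prob p n x y))
  (fun n => tabooR B n h y)).
- by move=> n; apply: fine_ge0; exact: step_prob_ge0.
- by move=> n; exact: tabooR_ge0.
- exact: tabooR_nonincreasing.
- have : \sum_(0 <= k < n) step_prob p k x y @[n --> \oo]
      --> (greenR x y)%:E.
    rewrite /greenR fineK ?green_fin//.
    by apply: is_cvg_nneseries => n _ _; exact: step_prob_ge0.
  move=> /fine_cvg; apply: cvg_trans; apply: near_eq_cvg; apply: nearW => n /=.
  by rewrite /series /= sum_fine// => k _; exact: step_prob_fin.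
- exact: residual_cvg.
Qed.

End Excessive.
End LastVisitLimit.

(** * Convergence of last visits to the boundary *)

Section BoundedConvergence.
Context d (T : measurableType d) (R : realType) (P : probability T R).

Lemma bounded_convergence (f_ : nat -> T -> R) (f : T -> R) (C : R) :
  (forall n, measurable_fun [set: T] (f_ n)) -> measurable_fun [set: T] f ->
  (forall n t, `|f_ n t| <= C) ->
  {ae P, forall t, f_ n t @[n --> \oo] --> f t} ->
  (\int[P]_t (f t)%:E)%E \is a fin_num /\
  (\int[P]_t (f_ n t)%:E @[n --> \oo] --> \int[P]_t (f t)%:E)%E.
Proof.
move=> mf_ mf fC cf.
have [|||||fint _ ?] := @dominated_convergence _ _ _ P setT measurableT
  (fun n t => (f_ n t)%:E) (EFin \o f) (cst C%:E) => //.
- by move=> n; exact/measurable_EFinP.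
- exact/measurable_EFinP.
- by apply: filterS cf => t ct _; apply: cvg_EFin => //; exact: nearW.
- by apply: finite_measure_integrable_cst.
- by apply: aeW => t n _ /=; rewrite lee_fin.
by split=> //; exact: integrable_fin_num.
Qed.

End BoundedConvergence.

Section Exhaustion.

(** The sets need not be nested: all that is used is that every state is
    eventually in them. *)
Definition exhausts (X : choiceType) (B : nat -> seq X) : Prop :=
  (forall j, uniq (B j)) /\
  forall x, \forall j \near \oo, x \in B j.

Lemma countable_exhaustion (X : pointedType) : countable [set: X] ->
  exists B : nat -> seq X, exhausts B.
Proof.
move=> /countable_enumeration[f [g fK]].
exists (fun j => undup [seq g i | i <- iota 0 j]); split=> [j|x].
  exact: undup_uniq.
exists (f x).+1 => // j /= xj; rewrite mem_undup; apply/mapP; exists (f x) => //.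
by rewrite mem_iota.
Qed.

End Exhaustion.

Section BoundaryLimit.
Context (R : realType) d (X : measurableType d) (hX : countable_discrete X)
  (p : X -> X -> R) (hp : markov_operator p) (htrans : transient p)
  d' (Omega : measurableType d') (Pr : X -> probability Omega R)
  (Z : nat -> {mfun Omega >-> X}) (hZ : markov_chain p Pr Z).

(** The mass [greenR p x y * residual p B h y] is the limit, as the horizon tends
    to infinity, of the expectation of [h] at the horizon on the event that the
    last visit to [B] takes place at [y]. *)
Definition last_exit_sum (B : seq X) (h phi : X -> R) (x : X) : R :=
  \sum_(y <- B) greenR p x y * residual p B h y * phi y.

Section Limit.
Context (B : nat -> seq X) (hB : exhausts B).
Context (phi : X -> R) (C : R) (phiC : forall z, 0 <= phi z <= C).

Let phi0 z : 0 <= phi z. Proof. by have /andP[] := phiC z. Qed.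

(** A diagonal argument.  For each [j] a horizon [N j >= j] is chosen at which the
    expectation of [phi] at the last visit to [B j] is within [j.+1^-1] of its
    limit.  Along any path, [Z i] lies in [B j] for all large [j], so the last
    visit before [N j] tends to infinity and the value of [phi] there tends to
    [Y]; bounded convergence concludes. *)
Lemma last_exit_sum_cvg x (Y : Omega -> R) : measurable_fun [set: Omega] Y ->
  {ae Pr x, forall w, phi (Z n w) @[n --> \oo] --> Y w} ->
  (\int[Pr x]_w (Y w)%:E)%E \is a fin_num /\
  last_exit_sum (B j) (fun=> 1) phi x @[j --> \oo] -->
    fine (\int[Pr x]_w (Y w)%:E)%E.
Proof.
move=> mY cY.
have C0 : 0 <= C by have /andP[] := phiC x; exact: le_trans.
have ex j : exists N, (j <= N)%N /\
    `|last_exit_sum (B j) (fun=> 1) phi x -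
      last_visit_sumR p (fun=> 1) (B j) phi N x| < j.+1%:R^-1.
  have /cvgrPdist_lt := @last_visit_sumR_cvg _ _ _ hp htrans _ _
    (bounded_excessive1 hp) (B j) phi x.
  move=> /(_ j.+1%:R^-1); rewrite invr_gt0 ltr0n => /(_ isT) [N _ hN].
  exists (maxn j N); split; first exact: leq_maxl.
  by apply: hN; exact: leq_maxr.
have {ex} [N hN] := choice ex.
pose g j w := last_value (B j) phi 0 (trajectory Z 0 (N j).+1 w).
have g_bnd j w : 0 <= g j w <= C.
  by rewrite /g; have [->|[z _ ->]] := last_valueP (B j) phi 0 (trajectory Z 0 (N j).+1 w);
    rewrite ?lexx.
have [Yfin cg] : (\int[Pr x]_w (Y w)%:E)%E \is a fin_num /\
  (\int[Pr x]_w (g j w)%:E @[j --> \oo] --> \int[Pr x]_w (Y w)%:E)%E.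
  apply: (@bounded_convergence _ _ _ (Pr x) g Y C) => //.
  - by move=> j; exact: measurable_trajectory.
  - by move=> j w; have /andP[? ?] := g_bnd j w; rewrite ger0_norm.
  apply: filterS cY => w /cvgrPdist_lt cw; apply/cvgrPdist_lt => e /cw[i _ hi].
  near=> j.
  have iN : (i <= N j)%N.
    by apply: leq_trans (hN j).1; near: j; exact: nbhs_infty_ge.
  have ZB : Z i w \in B j by near: j; exact: hB.2.
  rewrite /g; have [n + ->] := @last_value_trajectory _ _ _ _ _ Z (B j) phi 0 i (N j) w iN ZB.
  exact: hi.
have gE j : (\int[Pr x]_w (g j w)%:E =
    (last_visit_sumR p (fun=> 1) (B j) phi (N j) x)%:E)%E.
  rewrite (EFin_last_visit_sumR hp htrans (bounded_excessive1 hp)).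
  by rewrite (last_value_expectation hX hp hZ)//; exact: hB.1.
split=> //; move: cg; rewrite -(fineK Yfin) => /fine_cvg cg.
rewrite [X in X @ _ --> _](_ : _ = fun j =>
  fine (\int[Pr x]_w (g j w)%:E)%E + (last_exit_sum (B j) (fun=> 1) phi x -
      last_visit_sumR p (fun=> 1) (B j) phi (N j) x)); last first.
  by apply/funext => j; rewrite gE /= addrC subrK.
rewrite -[X in _ --> X]addr0; apply: cvgD; first exact: cg.
apply/norm_cvg0P.
apply: (@squeeze_cvgr _ _ _ _ (fun=> 0) (@harmonic R)).
- by apply: nearW => j; rewrite normr_ge0 ltW//; exact: (hN j).2.
- exact: cvg_cst.
- exact: cvg_harmonic.
Unshelve. all: by end_near.
Qed.

End Limit.

End BoundaryLimit.

(** * Harmonic functions and last exits *)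

Section BoundaryHarmonic.
Context (R : realType) d (X : measurableType d) (hX : countable_discrete X)
  (p : X -> X -> R) (hp : markov_operator p) (htrans : transient p)
  d' (Omega : measurableType d') (Pr : X -> probability Omega R)
  (Z : nat -> {mfun Omega >-> X}) (hZ : markov_chain p Pr Z).

Lemma residual_le B h M y : bounded_excessive p h M ->
  residual p B h y <= M * residual p B (fun=> 1) y.
Proof.
move=> hM; have M0 := excessive_bound_ge0 hM y.
have h1 := bounded_excessive1 hp.
apply: (ler_cvg_to (@residual_cvg _ _ _ hp _ _ hM B y)).
  apply: cvgMl_tmp; exact: (@residual_cvg _ _ _ hp _ _ h1 B y).
apply: nearW => n; rewrite -lee_fin EFinM (EFin_tabooR hp hM) (EFin_tabooR hp h1).
rewrite -tabooZl//=; apply: le_taboo => // z.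
by rewrite mule1 lee_fin; have /andP[] := hM.1 z.
Qed.

(** By [last_visit_sum_harmonic] the sum up to time [N] is equal to [h x] for every
    [N] when [x] is in [B], and so is its limit. *)
Lemma last_exit_sum_harmonic B h M x : uniq B -> x \in B ->
  (forall z, 0 <= h z <= M) ->
  (forall z, average p (EFin \o h) z = (h z)%:E) ->
  h x = last_exit_sum p B h (fun=> 1) x.
Proof.
move=> uB xB hM har.
have exh : bounded_excessive p h M by split=> // z; rewrite har.
have cS := @last_visit_sumR_cvg _ _ _ hp htrans _ _ exh B (fun=> 1) x.
have hE : last_visit_sumR p h B (fun=> 1) ^~ x = fun=> h x.
  apply/funext => N; apply: EFin_inj.
  rewrite (EFin_last_visit_sumR hp htrans exh).
  have := @last_visit_sum_harmonic _ _ _ hp B (EFin \o h) M N x uB.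
  by rewrite xB adde0; apply.
rewrite hE in cS; apply: cvg_unique cS => //; exact: cvg_cst.
Qed.

Lemma state_expectation x n (f : X -> R) : (forall z, 0 <= f z) ->
  (\int[Pr x]_w (f (Z n w))%:E =
   path_average p n (fun s => (f (last x s))%:E) x)%E.
Proof.
move=> f0; rewrite (_ : path_average _ _ _ _ =
    path_average p n (fun s => (f (last x (x :: s)))%:E) x)//.
rewrite -(path_expectation hX hp hZ x n (F := fun s => (f (last x s))%:E)).
  apply: eq_integral => w _; congr (f _)%:E.
  by rewrite /trajectory -(addn1 n) iotaD map_cat last_cat.
by move=> s; rewrite lee_fin.
Qed.

Lemma state_expectationS x n (f : X -> R) : (forall z, 0 <= f z) ->
  (\int[Pr x]_w (f (Z n.+1 w))%:E =
   average p (fun z => \int[Pr z]_w (f (Z n w))%:E) x)%E.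
Proof.
move=> f0; rewrite state_expectation//=; apply: eq_average => z.
by rewrite state_expectation//; apply: eq_path_average => s.
Qed.

Lemma average_expectation x (f : X -> R) : (forall z, 0 <= f z) ->
  (average p (EFin \o f) x = \int[Pr x]_w (f (Z 1 w))%:E)%E.
Proof. by move=> f0; rewrite state_expectation. Qed.

(** The expectations [u n] of [phi] at time [n] satisfy
    [u n.+1 = average (u n)] and converge to [h]; bounded convergence, applied to
    [u n] at the state reached after one step, allows passing to the limit. *)
Lemma limit_harmonic (phi : X -> R) (C : R) (Y : Omega -> R) :
  (forall z, 0 <= phi z <= C) -> measurable_fun [set: Omega] Y ->
  (forall x, {ae Pr x, forall w, phi (Z n w) @[n --> \oo] --> Y w}) ->
  let h x := fine (\int[Pr x]_w (Y w)%:E)%E in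
  (forall x, 0 <= h x <= C) /\ forall x, average p (EFin \o h) x = (h x)%:E.
Proof.
move=> phiC mY cY h.
have phi0 z : 0 <= phi z by have /andP[] := phiC z.
have meas n (f : X -> R) : measurable_fun [set: Omega] (fun w => f (Z n w)).
  exact: (measurableT_comp (measurable_fun_discrete hX f) (measurable_funPT (Z n))).
pose u n x := fine (\int[Pr x]_w (phi (Z n w))%:E)%E.
have int_bnd (f : X -> R) n x : (forall z, 0 <= f z <= C) ->
    (0 <= \int[Pr x]_w (f (Z n w))%:E <= C%:E)%E.
  move=> fC; apply/andP; split.
    by apply: integral_ge0 => w _; rewrite lee_fin; have /andP[] := fC (Z n w).
  rewrite -[leRHS]mule1 -(@probability_setT _ _ _ (Pr x)) -integral_cst//.
  apply: ge0_le_integral => //.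
  - by move=> w _; rewrite lee_fin; have /andP[] := fC (Z n w).
  - by apply/measurable_EFinP; exact: meas.
  - by move=> w _; rewrite lee_fin; have /andP[] := fC (Z n w).
have uE n x : (u n x)%:E = (\int[Pr x]_w (phi (Z n w))%:E)%E.
  rewrite fineK// fin_numElt; have /andP[a b] := int_bnd phi n x phiC.
  by rewrite (lt_le_trans _ a) ?ltNy0// (le_lt_trans b) ?ltry.
have uC n x : 0 <= u n x <= C by have := int_bnd phi n x phiC; rewrite -uE !lee_fin.
have cu x : (\int[Pr x]_w (Y w)%:E)%E \is a fin_num /\
    ((u n x)%:E @[n --> \oo] --> \int[Pr x]_w (Y w)%:E)%E.
  rewrite (_ : (fun n => (u n x)%:E) =
    fun n => \int[Pr x]_w (phi (Z n w))%:E)%E; last by apply/funext => n.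
  apply: (@bounded_convergence _ _ _ (Pr x) (fun n w => phi (Z n w)) Y C) => //.
  by move=> n w; rewrite ger0_norm//; have /andP[] := phiC (Z n w).
have cuh x : u n x @[n --> \oo] --> h x.
  by have [Yfin] := cu x; rewrite -(fineK Yfin) => /fine_cvg.
have hC x : 0 <= h x <= C.
  apply/andP; split.
    by apply: (cvgr_to_ge (cuh x)); apply: nearW => n; have /andP[] := uC n x.
  by apply: (cvgr_to_le (cuh x)); apply: nearW => n; have /andP[] := uC n x.
split=> // x; rewrite average_expectation; last by move=> z; have /andP[] := hC z.
have c1 : ((u n.+1 x)%:E @[n --> \oo] --> \int[Pr x]_w (h (Z 1 w))%:E)%E.
  rewrite [X in X @ _ --> _](_ : _ = fun n => (\int[Pr x]_w (u n (Z 1 w))%:E)%E).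
    have [] // := @bounded_convergence _ _ _ (Pr x) (fun n w => u n (Z 1%N w))
      (fun w => h (Z 1%N w)) C.
    - by move=> n w; rewrite ger0_norm; have /andP[] := uC n (Z 1%N w).
    - by apply: aeW => w; exact: cuh.
  apply/funext => n; rewrite uE state_expectationS// -average_expectation.
    by apply: eq_average => z; rewrite /= uE.
  by move=> z; have /andP[] := uC n z.
have c2 : ((u n.+1 x)%:E @[n --> \oo] --> (h x)%:E)%E.
  apply: cvg_EFin; first exact: nearW.
  by rewrite (cvg_shiftS (fun n => u n x)).
exact: (cvg_unique _ c1 c2).
Qed.

End BoundaryHarmonic.

(** * The Martin kernel and charges of finite support *)

Section MartinKernel.
Context (R : realType) d (X : measurableType d) (hX : countable_discrete X)
  (p : X -> X -> R) (hp : markov_operator p)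
  (hirr : irreducible p) (htrans : transient p)
  d' (Omega : measurableType d') (Pr : X -> probability Omega R)
  (Z : nat -> {mfun Omega >-> X}) (hZ : markov_chain p Pr Z).

Lemma greenR_hitting x y :
  greenR p x y = hitting_prob Pr Z x y * greenR p y y.
Proof.
have gfin := green_fin hp htrans y y.
by rewrite {1}/greenR (green_hitting hX hp hZ x gfin) fineM.
Qed.

Lemma greenR_gt0 x y : 0 < greenR p x y.
Proof.
have [n np] := hirr x y; rewrite -lte_fin /greenR fineK ?green_fin//.
apply: lt_le_trans np _.
apply: le_trans (@nneseries_lim_ge R (fun n => step_prob p n x y) xpredT 0 n.+1 _).
  rewrite big_nat_recr//= leeDr// sume_ge0// => i _; exact: step_prob_ge0.
by move=> k _ _; exact: step_prob_ge0.
Qed.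

Lemma greenR_martin_kernel o x y :
  greenR p x y = greenR p o y * martin_kernel Pr Z o x y.
Proof.
have := greenR_gt0 o y; rewrite (greenR_hitting o) => Fo.
have F0 : hitting_prob Pr Z o y != 0.
  by apply: contraTneq Fo => ->; rewrite mul0r ltxx.
by rewrite (greenR_hitting x) /martin_kernel [RHS]mulrC mulrA divfK.
Qed.

(** The residual depends on the exit place only, so a change of starting point
    affects the Green function alone, by the factor [martin_kernel]. *)
Lemma last_exit_sum_martin_kernel o B h phi x :
  last_exit_sum p B h phi x =
  last_exit_sum p B h (fun y => martin_kernel Pr Z o x y * phi y) o.
Proof.
apply: eq_bigr => y _; rewrite (greenR_martin_kernel o).
by rewrite -[LHS]mulrA mulrACA.
Qed.

End MartinKernel.

Section FiniteCharge.
Context (R : realType) d (X : measurableType d) (hX : countable_discrete X).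
Local Open Scope ereal_scope.

Lemma integral_finite_support (m : {measure set X -> \bar R}) (S : seq X)
    (h : X -> R) : uniq S -> (forall x, x \notin S -> m [set x] = 0) ->
  (forall x, m [set x] \is a fin_num) ->
  \int[m]_x (h x)%:E = (\sum_(x <- S) fine (m [set x]) * h x)%R%:E.
Proof.
move=> uS mS mfin; have [f [g fK]] := countable_enumeration hX.1.
have mh (D : set X) : measurable_fun D (EFin \o h).
  exact/measurable_funTS/(measurable_fun_discrete hX).
pose D := \big[setU/set0]_(x <- S) [set x].
have DE x : D x <-> x \in S.
  rewrite /D -bigcup_seq; split=> [[y yS /= ->]//|xS]; by exists x.
have nullC : m.-negligible (~` D).
  apply: (@negligibleS _ _ _ m (\bigcup_k if g k \in S then set0 else [set g k])).
    move=> x /DE xS; exists (f x) => //; rewrite fK.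
    by case: ifPn => // xS'.
  apply: negligible_bigcup => k; case: ifPn => [_|gS]; first exact: negligible_set0.
  by apply/negligibleP; [exact: hX.2|exact: mS].
transitivity (\int[m]_(x in D) (h x)%:E).
  rewrite [RHS]integral_mkcond; apply: ae_eq_integral => //.
  - exact: measurable_fun_discrete.
  - apply: negligibleS nullC => x /=; apply: contra_not => Dx _.
    by rewrite patchE mem_set.
rewrite /D integral_bigsetU_EFin//.
- rewrite -sumEFin; apply: eq_bigr => x _.
  rewrite EFinM fineK// muleC -(integral_cst m (hX.2 [set x])).
  by apply: eq_integral => y; rewrite inE => ->.
- by move=> x; exact: hX.2.
- by move=> x y _ _ [z [-> ->]].
Qed.

(** Both parts of the Jordan decomposition vanish at the points that [mu] does
    not charge: the positive part because it is a restriction of [mu], the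
    negative one as a difference.  The total mass is the case [h = 1]. *)
Lemma mean_value_defect_sum (mu : {charge set X -> \bar R}) :
  finitely_supported mu ->
  exists (S : seq X) (c : X -> R), forall h o,
    mean_value_defect h mu o = (\sum_(x <- S) c x * (h x - h o))%R.
Proof.
move=> /finite_seqP[s sE]; set S := undup s; exists S.
exists (fun x => fine (mu [set x])) => h o.
rewrite /mean_value_defect /charge_integral.
set HP := cid _; set HN := cid _.
have hd := projT2 HN.
have S0 x : x \notin S -> mu [set x] = 0.
  rewrite mem_undup; apply: contraNeq => mux.
  by have : [set x | mu [set x] != 0] x by []; rewrite sE.
have posE x : x \notin S -> jordan_pos hd [set x] = 0.
  move=> xS; rewrite jordan_posE cjordan_posE /crestr0 mem_set//; last exact: hX.2.
  rewrite /crestr; have [Px|Px] := pselect (projT1 HP x).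
    by rewrite (_ : _ `&` _ = [set x]) ?S0//; apply/setIidPl => y ->.
  rewrite (_ : _ `&` _ = set0) ?charge0//.
  by apply/seteqP; split=> // y [/= -> /Px].
have negE x : x \notin S -> jordan_neg hd [set x] = 0.
  move=> xS; have := jordan_decomp hd (hX.2 [set x]).
  rewrite /cadd/= cscaleN1 S0//= posE// add0e => /esym/eqP.
  by rewrite oppe_eq0 => /eqP.
have fin_pos x : jordan_pos hd [set x] \is a fin_num.
  by apply: fin_num_measure; exact: hX.2.
have fin_neg x : jordan_neg hd [set x] \is a fin_num.
  by apply: fin_num_measure; exact: hX.2.
have intE (k : X -> R) : \int[jordan_pos hd]_x (k x)%:E -
    \int[jordan_neg hd]_x (k x)%:E =
    (\sum_(x <- S) fine (mu [set x]) * k x)%R%:E.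
  rewrite !(@integral_finite_support _ S)// ?undup_uniq//.
  rewrite -EFinB -sumrB; congr EFin; apply: eq_bigr => x _.
  rewrite -mulrBl; congr (_ * _)%R.
  rewrite (jordan_decomp hd (hX.2 [set x])) /cadd/= cscaleN1.
  by rewrite fineB ?fin_pos ?fin_neg.
rewrite intE /=.
have := intE (fun=> 1%R); rewrite !integral_cst// !mul1e.
have -> : jordan_pos hd [set: X] - jordan_neg hd [set: X] = mu [set: X].
  by rewrite (jordan_decomp hd measurableT) /cadd/= cscaleN1.
move=> ->; rewrite /= mulr_suml -sumrB; apply: eq_bigr => x _.
by rewrite mulr1 mulrBr.
Qed.

End FiniteCharge.

(** * Bounded harmonic functions and continuous functions *)

Section BoundedHarmonic.
Context (R : realType) (X : choiceType) (p : X -> X -> R)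
  (hp : markov_operator p).

(** [average] is a sum in the extended sense, meaningful for nonnegative
    functions only; adding a bound [M] makes the function nonnegative, and constants are harmonic.  The
    positive and negative parts in [rsum] are finite because [h] is bounded. *)
Lemma bounded_harmonic_average (h : X -> R) : bounded_harmonic p h ->
  exists M : R, (forall x, 0 <= h x + M <= M + M) /\
    forall x, average p (EFin \o (fun z => h z + M)) x = (h x + M)%:E.
Proof.
move=> [har [M hM]]; exists M.
have hMz z : 0 <= h z + M <= M + M.
  have := hM z; rewrite ler_norml => /andP[a b].
  by rewrite lerD2r b andbT -lerBlDr sub0r.
split=> // x; have M0 : 0 <= M by exact: le_trans (hM x).
have [_] := har x; rewrite /rsum; set f := fun y => p x y * h y.
have p0 z : 0 <= p x z by exact: hp.1.
have bnd (g : X -> R) : (forall z, 0 <= g z <= p x z * M) ->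
    (\esum_(z in [set: X]) (g z)%:E)%E \is a fin_num.
  move=> gM; rewrite ge0_fin_numE; last first.
    by apply: esum_ge0 => z _; rewrite lee_fin; have /andP[] := gM z.
  apply: (@le_lt_trans _ _ (average p (fun=> M%:E) x)).
    by apply: le_esum => z _; rewrite -EFinM lee_fin; have /andP[] := gM z.
  by rewrite average_cst// ltry.
have fM z : `|f z| <= p x z * M by rewrite normrM ger0_norm// ler_wpM2l.
have posM z : 0 <= f^\+ z <= p x z * M.
  rewrite funrpos_ge0/=; apply: le_trans (fM z).
  by rewrite /funrpos ge_max ler_norm normr_ge0.
have negM z : 0 <= f^\- z <= p x z * M.
  rewrite funrneg_ge0/=; apply: le_trans (fM z).
  by rewrite /funrneg ge_max normr_ge0 andbT -normrN ler_norm.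
move=> hx; set a := (\esum_(z in _) (f^\+ z)%:E)%E in hx.
set b := (\esum_(z in _) (f^\- z)%:E)%E in hx.
have afin : a \is a fin_num by exact: bnd.
have bfin : b \is a fin_num by exact: bnd.
have : (average p (EFin \o (fun z => h z + M)%R) x + b = M%:E + a)%E.
  rewrite -(average_cst hp x M0) /average /a /b -!esumD//.
  - apply: eq_esum => z _; rewrite /= -!EFinM -!EFinD; congr EFin.
    rewrite mulrDr -/(f z) addrAC addrC; congr (_ + _).
    by have /(congr1 (fun u => u z)) /= <- := funrposBneg f; rewrite subrK.
  - by move=> z _; rewrite -EFinM lee_fin mulr_ge0.
  - by move=> z _; rewrite lee_fin funrpos_ge0.
  - by move=> z _; rewrite lee_fin mulr_ge0//; have /andP[] := hMz z.
  - by move=> z _; rewrite lee_fin funrneg_ge0.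
move=> /(congr1 (fun u => u - b)%E); rewrite addeK// => ->.
by rewrite -(fineK afin) -(fineK bfin) -EFinD -addrA hx addrC.
Qed.

Lemma average_bounded_harmonic (h : X -> R) (M : R) :
  (forall x, 0 <= h x <= M) ->
  (forall x, average p (EFin \o h) x = (h x)%:E) -> bounded_harmonic p h.
Proof.
move=> hM har; have h0 x : 0 <= h x by have /andP[] := hM x.
split; last first.
  by exists M => x; rewrite ger0_norm//; have /andP[] := hM x.
move=> x; have ph0 y : 0 <= p x y * h y by rewrite mulr_ge0//; exact: hp.1.
split.
  rewrite /summable (_ : esum _ _ = average p (EFin \o h) x); first by rewrite har ltry.
  by apply: eq_esum => y _; rewrite gee0_abs ?lee_fin// EFinM.
rewrite /rsum (_ : esum _ _ = average p (EFin \o h) x); last first.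
  by apply: eq_esum => y _; rewrite (@ge0_funrposE _ _ setT) ?inE// EFinM.
rewrite har esum1 ?subr0// => y _; by rewrite (@ge0_funrnegE _ _ setT) ?inE.
Qed.

End BoundedHarmonic.

Lemma compact_continuous_bounded (R : realType) (T : topologicalType)
    (f : T -> R) : compact [set: T] -> continuous f ->
  exists C : R, forall t, `|f t| <= C.
Proof.
move=> cT cf.
have : compact (f @` [set: T]).
  by apply: continuous_compact => //; exact: continuous_subspaceT.
move=> /compact_bounded[M [_ hM]]; exists (M + 1) => t.
by apply: (hM (M + 1)); [rewrite ltrDl|exists t].
Qed.

Lemma continuous_borel_measurable (R : realType) (Y : ptopologicalType)
    (f : Y -> R) : continuous f ->
  measurable_fun [set: borel Y] (f : borel Y -> R).
Proof.
move=> cf.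
apply: (measurability _ (RGenOInfty.measurableE R)).
move=> _ [_ [a ->] <-]; rewrite setTI; apply: sub_sigma_algebra.
by apply: open_comp => // y _; exact: cf.
Qed.

(** * The two implications *)

Section Main.
Context (R : realType) d (X : measurableType d) (hX : countable_discrete X)
  (p : X -> X -> R) (hp : markov_operator p)
  (hirr : irreducible p) (htrans : transient p)
  d' (Omega : measurableType d') (Pr : X -> probability Omega R)
  (Z : nat -> {mfun Omega >-> X}) (hZ : markov_chain p Pr Z) (o : X)
  (Xhat : ptopologicalType) (iota : X -> Xhat) (cptX : compact [set: Xhat])
  (k : X -> Xhat -> R)
  (hk : forall x, continuous_extension iota (martin_kernel Pr Z o x) (k x))
  (Zoo : {mfun Omega >-> borel Xhat}) (hZoo : limit_variable Pr Z iota Zoo).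
Context (S : seq X) (c : X -> R).

(* The mean value defect of a charge with masses [c] on the points of [S]. *)
Let L (h : X -> R) := \sum_(x <- S) c x * (h x - h o).
Let Phi (xi : Xhat) := L (k ^~ xi).

Lemma continuous_defect : continuous Phi.
Proof.
move=> xi; rewrite /Phi /L; apply: cvg_big => [|x _]; first exact: add_continuous.
by apply: cvgMl_tmp; apply: cvgB; exact: (hk _).1.
Qed.

(** After all starting points have been changed to [o], the finite sum over the
    support of [mu] only involves the Martin kernel, and is [Phi]. *)
Lemma defect_last_exit_sum B h phi :
  L (last_exit_sum p B h phi) =
  last_exit_sum p B h (fun y => Phi (iota y) * phi y) o.
Proof.
have les x : last_exit_sum p B h phi x =
    last_exit_sum p B h (fun y => k x (iota y) * phi y) o.
  rewrite (last_exit_sum_martin_kernel hX hp hirr htrans hZ o).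
  by apply: eq_bigr => y _; rewrite (hk x).2.
rewrite /L; under eq_bigr do rewrite les (les o).
rewrite /last_exit_sum; under eq_bigr do rewrite -sumrB mulr_sumr.
rewrite exchange_big; apply: eq_bigr => y _ /=.
rewrite /Phi /L mulr_suml mulr_sumr; apply: eq_bigr => x _.
by rewrite -mulrBr -mulrBl mulrCA; congr (_ * _); rewrite mulrA.
Qed.

Lemma cvg_defect (u : nat -> X -> R) (h : X -> R) :
  (forall x, u j x @[j --> \oo] --> h x) -> L (u j) @[j --> \oo] --> L h.
Proof.
move=> cu; rewrite /L; apply: cvg_big => [|x _]; first exact: add_continuous.
by apply: cvgMl_tmp; apply: cvgB; exact: cu.
Qed.

Section ContinuousLimit.
Context (phi : Xhat -> R) (cphi : continuous phi).

Lemma measurable_boundary_value :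
  measurable_fun [set: Omega] (fun w => phi (Zoo w)).
Proof.
exact: (measurableT_comp (continuous_borel_measurable cphi) (measurable_funPT Zoo)).
Qed.

Lemma boundary_value_cvg x :
  {ae Pr x, forall w, phi (iota (Z n w)) @[n --> \oo] --> phi (Zoo w)}.
Proof.
apply: filterS (hZoo.2 x) => w cw.
exact: (cvg_comp _ _ cw (@cphi (Zoo w : Xhat))).
Qed.

End ContinuousLimit.

(** The bound [residual B g <= (M + M) * residual B 1] replaces the residual of
    the unknown harmonic function by a quantity whose limit is an expectation
    at the boundary. *)
Lemma weak_mean_value_of_kernel :
  {ae Pr o, forall w, Phi (Zoo w) = 0} ->
  forall h, bounded_harmonic p h -> L h = 0.
Proof.
move=> Phi0 h /(bounded_harmonic_average hp)[M [hM har]].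
pose g x := h x + M.
have -> : L h = L g.
  by apply: eq_bigr => x _; rewrite /g opprD addrACA subrr addr0.
have [B hB] := countable_exhaustion hX.1.
have exg : bounded_excessive p g (M + M) by split=> // z; rewrite har.
have cN : continuous (fun xi => `|Phi xi|).
  by move=> xi; apply: cvg_norm; exact: continuous_defect.
have [C hC] := compact_continuous_bounded cptX cN.
have bnd y : 0 <= `|Phi (iota y)| <= C.
  by rewrite normr_ge0 (le_trans (ler_norm _) (hC _)).
have [Yfin cY] := last_exit_sum_cvg hX hp htrans hZ hB bnd
  (measurable_boundary_value cN) (boundary_value_cvg cN o).
have Y0 : (\int[Pr o]_w (`|Phi (Zoo w)|)%:E = 0)%E.
  transitivity (\int[Pr o]_w (cst 0%E w))%E; last exact: integral0.
  apply: ae_eq_integral => //.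
    by apply/measurable_EFinP; exact: (measurable_boundary_value cN).
  by apply: filterS Phi0 => w /= -> _; rewrite normr0.
rewrite Y0 /= in cY.
have M0 := excessive_bound_ge0 exg o.
have cMY : (M + M) * last_exit_sum p (B j) (fun=> 1) (fun y => `|Phi (iota y)|) o
    @[j --> \oo] --> 0.
  by rewrite -(mulr0 (M + M)); exact: cvgMl_tmp.
apply/eqP; rewrite -normr_le0; apply: (cvgr_to_ge cMY).
(* The representation of [g] by last exits holds at the points of [B j] only. *)
have memB : \forall j \near \oo, forall x, x \in o :: S -> x \in B j.
  elim: (o :: S) => [|y s IH]; first exact: nearW.
  near=> j => x; rewrite inE => /orP[/eqP->|].
    by near: j; exact: hB.2.
  by move: x; near: j.
near=> j.
have -> : L g = L (last_exit_sum p (B j) g (fun=> 1)).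
  have hj : forall x, x \in o :: S -> x \in B j by near: j.
  apply: eq_big_seq => x xS.
  rewrite !(@last_exit_sum_harmonic _ _ _ _ hp htrans (B j) g (M + M))//.
  - exact: hB.1.
  - by apply: hj; rewrite mem_head.
  - exact: hB.1.
  - by apply: hj; rewrite inE xS orbT.
rewrite defect_last_exit_sum /last_exit_sum mulr_sumr.
apply: le_trans (ler_norm_sum _ _ _) _; apply: ler_sum => y _.
rewrite mulr1 !normrM (ger0_norm (greenR_ge0 hp o y)).
rewrite (ger0_norm (residual_ge0 hp exg (B j) y)).
rewrite mulrA ler_wpM2r// mulrCA ler_wpM2l ?greenR_ge0//.
exact: residual_le.
Unshelve. all: by end_near.
Qed.

(** Testing the mean value property on the boundary data [Phi + C] and 1 amounts to
    testing [Phi] against itself. *)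
Lemma kernel_of_weak_mean_value :
  (forall h, bounded_harmonic p h -> L h = 0) ->
  forall x, {ae Pr x, forall w, Phi (Zoo w) = 0}.
Proof.
move=> wmv x.
have [B hB] := countable_exhaustion hX.1.
have [C hC] := compact_continuous_bounded cptX continuous_defect.
have C0 : 0 <= C by exact: le_trans (hC (iota x)).
have les_cvg (phi : Xhat -> R) D : continuous phi ->
    (forall xi, 0 <= phi xi <= D) ->
    forall y, (\int[Pr y]_w (phi (Zoo w))%:E)%E \is a fin_num /\
    last_exit_sum p (B j) (fun=> 1) (phi \o iota) y @[j --> \oo] -->
      fine (\int[Pr y]_w (phi (Zoo w))%:E)%E.
  move=> cphi phiD y.
  exact: (last_exit_sum_cvg hX hp htrans hZ hB (fun z => phiD (iota z))
    (measurable_boundary_value cphi) (boundary_value_cvg cphi y)).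
have L_les (phi : Xhat -> R) D : continuous phi ->
    (forall xi, 0 <= phi xi <= D) ->
    L (last_exit_sum p (B j) (fun=> 1) (phi \o iota)) @[j --> \oo] --> 0.
  move=> cphi phiD.
  have [hD har] := limit_harmonic hX hp hZ (fun z => phiD (iota z))
    (measurable_boundary_value cphi) (boundary_value_cvg cphi).
  rewrite -(wmv _ (average_bounded_harmonic hp hD har)).
  by apply: cvg_defect => y; exact: (les_cvg _ _ cphi phiD y).2.
have cPhiC : continuous (fun xi => Phi xi + C).
  by move=> xi; apply: cvgD; [exact: continuous_defect|exact: cvg_cst].
have PhiC xi : 0 <= Phi xi + C <= C + C.
  have := hC xi; rewrite ler_norml => /andP[a b].
  by rewrite lerD2r b andbT -lerBlDr sub0r.
have c1 := L_les _ _ cPhiC PhiC.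
have c2 := L_les (fun=> 1) 1 (fun=> cvg_cst _) (fun=> ltac:(by rewrite ler01 lexx)).
have cSq : continuous (fun xi => Phi xi ^+ 2).
  by move=> xi; apply: (@cvg_comp _ _ _ Phi (fun t => t ^+ 2));
    [exact: continuous_defect|exact: exprn_continuous].
have Sq xi : 0 <= Phi xi ^+ 2 <= C ^+ 2.
  by rewrite sqr_ge0 -[leLHS]real_normK ?num_real// ler_pXn2r// ?nnegrE//= hC.
(* [Phi ^+ 2 = Phi * (Phi + C) - C * Phi]. *)
have co : last_exit_sum p (B j) (fun=> 1) (fun y => Phi (iota y) ^+ 2) o
    @[j --> \oo] --> 0.
  have : L (last_exit_sum p (B j) (fun=> 1) (fun y => Phi (iota y) + C)) -
      C * L (last_exit_sum p (B j) (fun=> 1) (fun=> 1)) @[j --> \oo] --> 0 - C * 0.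
    by apply: cvgB; [exact: c1|apply: cvgMl_tmp; exact: c2].
  rewrite mulr0 subr0; apply: cvg_trans; apply: near_eq_cvg; apply: nearW => j.
  rewrite !defect_last_exit_sum /last_exit_sum mulr_sumr -sumrB.
  apply: eq_bigr => y _; rewrite mulr1 [C * _]mulrCA -mulrBr; congr (_ * _).
  by rewrite mulrDr -expr2 [C * _]mulrC addrK.
have [D hD] := compact_continuous_bounded cptX (hk x).1.
have D0 : 0 <= D by exact: le_trans (hD (iota x)).
have [Yfin cx] := les_cvg _ _ cSq Sq x.
(* Starting from [x] instead of [o] multiplies the weights by [k x <= D]. *)
have Y0 : (\int[Pr x]_w (Phi (Zoo w) ^+ 2)%:E = 0)%E.
  rewrite -(fineK Yfin); congr EFin; apply/eqP; rewrite eq_le; apply/andP; split.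
    have cDo : D * last_exit_sum p (B j) (fun=> 1) (fun y => Phi (iota y) ^+ 2) o
        @[j --> \oo] --> 0 by rewrite -(mulr0 D); exact: cvgMl_tmp.
    apply: (ler_cvg_to cx cDo); apply: nearW => j.
    rewrite (last_exit_sum_martin_kernel hX hp hirr htrans hZ o) /last_exit_sum.
    rewrite mulr_sumr; apply: ler_sum => y _; rewrite [leRHS]mulrCA.
    apply: ler_wpM2l.
      by rewrite mulr_ge0 ?greenR_ge0// (residual_ge0 hp (bounded_excessive1 hp)).
    apply: ler_wpM2r; first exact: sqr_ge0.
    by rewrite -(hk x).2 (le_trans (ler_norm _)).
  by apply/fine_ge0/integral_ge0 => w _; rewrite lee_fin sqr_ge0.
have mSq := measurable_boundary_value cSq.
have := (ae_eq_integral_abs (Pr x) measurableT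
  (f := fun w => (Phi (Zoo w) ^+ 2)%:E) _).1.
have -> : (\int[Pr x]_w `|(Phi (Zoo w) ^+ 2)%:E| =
  \int[Pr x]_w (Phi (Zoo w) ^+ 2)%:E)%E.
  by apply: eq_integral => w _; rewrite gee0_abs// lee_fin sqr_ge0.
move=> /(_ _ Y0) ae0.
have {ae0} := ae0 ltac:(exact/measurable_EFinP).
apply: filterS => w /= /(_ Logic.I) [] /eqP.
by rewrite sqrf_eq0 => /eqP.
Qed.

End Main.

Theorem theorem8
  (R : realType)
  (d : measure_display) (X : measurableType d) (hX : countable_discrete X)
  (p : X -> X -> R) (hp : markov_operator p)
  (hirr : irreducible p) (htrans : transient p)
  (d' : measure_display) (Omega : measurableType d')
  (Pr : X -> probability Omega R) (Z : nat -> {mfun Omega >-> X})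
  (hZ : markov_chain p Pr Z)
  (o : X)
  (Xhat : ptopologicalType) (iota : X -> Xhat)
  (hXhat : martin_compactification Pr Z o iota)
  (k : X -> Xhat -> R)
  (hk : forall x, continuous_extension iota (martin_kernel Pr Z o x) (k x))
  (Zoo : {mfun Omega >-> borel Xhat}) (hZoo : limit_variable Pr Z iota Zoo)
  (mu : {charge set X -> \bar R}) (hmu : finitely_supported mu) :
  let assertion_i := weak_mean_value p mu o in
  let assertion_ii :=
    forall x, {ae harmonic_measure Pr Zoo x, forall xi : Xhat,
      boundary iota xi -> mean_value_defect (k ^~ xi) mu o = 0} in
  (assertion_ii -> assertion_i) /\
  (almost_regular Pr iota Zoo -> (assertion_i <-> assertion_ii)).
Proof.
move=> ai aii; have [S [c defE]] := mean_value_defect_sum hX hmu.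
have [[cptX _ _ _ _] _ _] := hXhat.
pose Phi xi := \sum_(x <- S) c x * (k x xi - k o xi).
have ii_i : aii -> ai.
  move=> hii h hh; rewrite defE.
  apply: (weak_mean_value_of_kernel hX hp hirr htrans hZ cptX hk hZoo _ hh).
  have [N [mN N0 subN]] := hii o.
  exists (Zoo @^-1` N); split=> //; first exact: measurable_funPTI.
  move=> w /= Phiw; apply: subN => /= hN; apply: Phiw.
  by rewrite -defE; apply: hN; exact: hZoo.1.
split=> // _; split=> // hi x.
have wmv h : bounded_harmonic p h -> \sum_(y <- S) c y * (h y - h o) = 0.
  by move=> hh; rewrite -defE; exact: hi.
have Phi0 := kernel_of_weak_mean_value hX hp hirr htrans hZ cptX hk hZoo wmv x.
have mPhi : measurable [set xi : borel Xhat | Phi xi != 0].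
  rewrite (_ : mkset _ = (Phi : borel Xhat -> R) @^-1` (~` [set 0])); last first.
    by apply/seteqP; split=> xi /= /eqP.
  rewrite -[X in measurable X]setTI.
  apply: (continuous_borel_measurable (continuous_defect hk (S := S) (c := c))) => //.
  exact: measurableC.
exists [set xi : borel Xhat | Phi xi != 0]; split=> //.
  have : Pr x (Zoo @^-1` [set xi : borel Xhat | Phi xi != 0]) = 0%E.
    apply/negligibleP; first exact: (measurable_funPTI Zoo).
    by apply: negligibleS Phi0 => w /= /eqP.
  exact.
move=> xi /= hxi; apply/eqP => Phixi; apply: hxi => _.
by rewrite defE.
Qed.
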